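(* Suppose that $\rho_1$ and $\rho_2$ are calibration functions and that $\rho_1(t)=\psi(\rho_2(t))$, where $\psi(t)/t$ is an increasing function of $t$ that is unbounded as $t\to\infty$. Then there exists a bounded sequence of weights (positive real numbers) $\mathbf{w}=(w_n)_{n=1}^\infty$ such that: (i) $B_{\mathbf{w}}$ is $\rho_2$-frequently hypercyclic on $\ell^1(\mathbb{N})$; (ii) $B_{\mathbf{w}}$ is not $\rho_1$-frequently hypercyclic on $\ell^1(\mathbb{N})$.
   Context: $\mathbb{N}=\{1,2,3,\dots\}$. A calibration function is a function $\rho\colon[0,\infty)\to[0,\infty)$ such that: (1) $\rho$ is continuous, strictly increasing and unbounded; (2) $|\rho(t_1)-\rho(t_2)|\le|t_1-t_2|$ for all $t_1,t_2\ge0$; (3) $\rho$ is concave; (4) $\rho(t)/t$ is a non-increasing function of $t>0$; normalized so that $\rho(0)=0$. (Only the behaviour of $\rho$ for large $t$ matters, and functions having these properties only for large $t$ are regarded as calibration functions after modification for small $t$.) The lower $\rho$-density of $\mathcal{A}\subseteq\mathbb{N}$ is $\liminf_{N\to\infty}\frac{\#\{n\in\mathcal{A}: n\le N\}}{\rho(N)}\in[0,\infty]$. A continuous linear operator $T$ on a separable infinite-dimensional Fréchet space $X$ is $\rho$-frequently hypercyclic if there is $x\in X$ such that, for each nonempty open $U\subset X$, the return set $\{n\in\mathbb{N}: T^nx\in U\}$ has positive lower $\rho$-density. Elements of $\ell^1(\mathbb{N})$ are written $(x_0,x_1,x_2,\dots)$. For a bounded sequence $\mathbf{w}=(w_n)_{n=1}^\infty$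 of positive reals, the weighted backward shift $B_{\mathbf{w}}$ is $B_{\mathbf{w}}(x_0,x_1,x_2,\dots)=(w_1x_1,w_2x_2,w_3x_3,\dots)$. ''Increasing'' is understood in the non-strict sense; $\psi(t)/t$ is considered for $t>0$. *)

(* Defs.v *)
From HB Require Import structures.
From mathcomp Require Import all_boot all_order all_algebra.
From mathcomp Require Import complex.
From mathcomp Require Import all_classical all_reals all_analysis.

Set Implicit Arguments.
Unset Strict Implicit.
Unset Printing Implicit Defensive.

Import Order.TTheory GRing.Theory Num.Def Num.Theory.
Import numFieldNormedType.Exports.

Local Open Scope classical_set_scope.
Local Open Scope ring_scope.

(* Functions on [0, +oo) are represented by functions on R of which only the
   restriction to [0, +oo) matters. *)
Record calibration (R : realType) (rho : R -> R) : Prop := Calibration {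
  calibration_ge0 : forall t, 0 <= t -> 0 <= rho t;
  calibration0 : rho 0 = 0;
  calibration_continuous : {within `[0, +oo[, continuous rho};
  calibration_increasing : {in `[0, +oo[ &, {homo rho : s t / s < t}};
  calibration_unbounded : forall M, exists2 t, 0 <= t & M < rho t;
  calibration_lipschitz : forall s t, 0 <= s -> 0 <= t ->
    `|rho s - rho t| <= `|s - t|;
  calibration_concave : forall s t l, 0 <= s -> 0 <= t -> 0 <= l <= 1 ->
    l * rho s + (1 - l) * rho t <= rho (l * s + (1 - l) * t);
  calibration_ratio : {in `]0, +oo[ &, {homo (fun t => rho t / t) :
    s t / s <= t >-> t <= s}}
}.

(* Only the elements n >= 1 of A are counted, and the term N = 0 is irrelevant
   to the limit inferior. *)
Definition lower_density (R : realType) (rho : R -> R) (A : set nat) : \bar R :=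
  limn_einf (fun N : nat =>
    ((\sum_(1 <= n < N.+1 | n \in A) 1)%N%:R / rho N%:R)%:E).

(* The continuity of T and the assumptions that X is a separable
   infinite-dimensional Fréchet space are not part of this predicate, which is
   only used for the continuous operator [wshift] on [ell1] (see
   [wshift_continuous]). *)
Definition frequently_hypercyclic (R : realType) (rho : R -> R)
    (X : tvsType R) (T : {linear X -> X}) : Prop :=
  exists x : X, forall U : set X, open U -> U !=set0 ->
    (0 < lower_density rho [set n | U (iter n T x)])%E.

Section ell1.
Context {R : realType} (V : normedModType R).
Implicit Types x y : nat -> V.

Definition ell1_pred : {pred nat -> V} :=
  fun x => `[< cvgn (series (fun n => `|x n|)) >].

Lemma ell1P x : reflect (cvgn (series (fun n => `|x n|))) (x \in ell1_pred).
Proof. exact: asboolP. Qed.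

Lemma ell1_dominated x (u : R^nat) :
  (forall n, `|x n| <= u n) -> cvgn (series u) -> x \in ell1_pred.
Proof.
move=> xu cu; apply/ell1P; apply: series_le_cvg cu => // n.
exact: le_trans (xu n).
Qed.

Lemma ell1_bounded x M :
  (forall n, series (fun k => `|x k|) n <= M) -> x \in ell1_pred.
Proof.
move=> xM; apply/ell1P; apply: nondecreasing_is_cvgn.
  exact: nondecreasing_series.
by exists M => _ [n _ <-].
Qed.

Lemma ell1_submod_closed : submod_closed ell1_pred.
Proof.
split.
  by apply: (@ell1_bounded _ 0) => n; rewrite /series/= big1// => i _; rewrite normr0.
move=> a x y /ell1P cx /ell1P cy.
apply: (@ell1_dominated _ (`|a| *: (fun n => `|x n|) + (fun n => `|y n|))).
  by move=> n /=; rewrite (le_trans (ler_normD _ _))// normrZ.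
by apply: is_cvg_seriesD => //; exact: is_cvg_seriesZ.
Qed.

HB.instance Definition _ :=
  GRing.isSubmodClosed.Build R (nat -> V) ell1_pred ell1_submod_closed.

Record ell1 := Ell1 { ell1_val :> nat -> V ; ell1_valP : ell1_val \in ell1_pred }.

HB.instance Definition _ := [isSub for ell1_val].
HB.instance Definition _ := [Choice of ell1 by <:].
HB.instance Definition _ := [SubChoice_isSubLmodule of ell1 by <:].

Definition ell1_norm (x : ell1) : R := limn (series (fun n => `|x n|)).

Lemma ell1_cvg (x : ell1) : cvgn (series (fun n => `|x n|)).
Proof. exact/ell1P/ell1_valP. Qed.

Lemma ell1_series_le (x : ell1) n : series (fun k => `|x k|) n <= ell1_norm x.
Proof.
apply: nondecreasing_cvgn_le; last exact: ell1_cvg.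
exact: nondecreasing_series.
Qed.

Lemma ell1_norm_le (x : ell1) M :
  (forall n, series (fun k => `|x k|) n <= M) -> ell1_norm x <= M.
Proof. by move=> xM; apply: limr_le; [exact: ell1_cvg|exact: nearW]. Qed.

Lemma ell1_coord_le (x : ell1) n : `|x n| <= ell1_norm x.
Proof.
apply: le_trans (ell1_series_le x n.+1).
by rewrite /series/= big_nat_recr//= lerDr sumr_ge0.
Qed.

Lemma ell1_normD (x y : ell1) : ell1_norm (x + y) <= ell1_norm x + ell1_norm y.
Proof.
apply: ell1_norm_le => n.
apply: le_trans (lerD (ell1_series_le x n) (ell1_series_le y n)).
by rewrite /series/= -big_split/=; apply: ler_sum => i _; exact: ler_normD.
Qed.

Lemma ell1_normZ (a : R) (x : ell1) : ell1_norm (a *: x) = `|a| * ell1_norm x.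
Proof.
apply: etrans (lim_seriesZ `|a| (@ell1_cvg x)).
by congr (limn (series _)); apply/funext => n /=; rewrite normrZ.
Qed.

Lemma ell1_norm0_eq0 (x : ell1) : ell1_norm x = 0 -> x = 0.
Proof.
move=> x0; apply/val_inj/funext => n; apply/eqP.
by rewrite -normr_le0 -x0 ell1_coord_le.
Qed.

HB.instance Definition _ :=
  Lmodule_isNormed.Build R ell1 ell1_normD ell1_normZ ell1_norm0_eq0.

Lemma ell1_normE (x : ell1) : `|x| = limn (series (fun n => `|x n|)).
Proof. by []. Qed.

End ell1.

Arguments ell1_pred {R} V.

Section ell1_complete.
Context {R : realType} (V : completeNormedModType R).

Lemma ell1_complete (F : set_system (ell1 V)) :
  ProperFilter F -> cauchy F -> cvg F.
Proof.
move=> FF /cauchy_ballP Fc.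
have coord n : cvg ((fun x : ell1 V => x n) @ F).
  apply/cauchy_cvgP/cauchy_ballP => e e0.
  have [[A B] [/= FA FB] AB] := Fc e e0.
  exists ((fun x : ell1 V => x n) @` A, (fun x : ell1 V => x n) @` B) => /=.
    by split; [apply: filterS FA|apply: filterS FB] => x /= ?; exists x.
  move=> [_ _] /= [[x Ax <-] [y By <-]].
  have := AB (x, y) (conj Ax By); rewrite -!ball_normE /=.
  by apply: le_lt_trans; exact: (ell1_coord_le (x - y)).
pose l n := lim ((fun x : ell1 V => x n) @ F).
have key e : 0 < e ->
    F [set x : ell1 V | forall n, series (fun k => `|l k - x k|) n <= e].
  move=> e0; have [[A B] [/= FA FB] AB] := Fc e e0.
  apply: filterS FA => x Ax n.
  have cn : (fun y : ell1 V => series (fun k => `|y k - x k|) n) @ F -->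
      series (fun k => `|l k - x k|) n.
    elim: n => [|n IHn].
      rewrite /series /= big_geq//; under eq_fun do rewrite big_geq//.
      exact: cvg_cst.
    rewrite seriesSr; under eq_fun do rewrite seriesSr.
    apply: cvgD => //; apply: cvg_norm; apply: cvgB; last exact: cvg_cst.
    exact: coord.
  apply: (cvgr_to_le cn).
  apply: filterS FB => y By /=.
  have := AB (x, y) (conj Ax By); rewrite -ball_normE /= => /ltW.
  rewrite distrC; apply: le_trans; exact: (ell1_series_le (y - x)).
have [x xl] := filter_ex (key 1 ltr01).
have lx : (fun k => l k - x k) \in ell1_pred V by exact: ell1_bounded xl.
pose L : ell1 V := Ell1 lx + x.
have LE k : L k = l k by rewrite /= subrK.
apply/cvg_ex; exists L; apply/cvgrPdist_le => e e0.
apply: filterS (key e e0) => y yl; apply: ell1_norm_le => n.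
apply: le_trans (yl n); rewrite /series /=; apply: ler_sum => k _.
by rewrite subrK.
Qed.

HB.instance Definition _ := Uniform_isComplete.Build (ell1 V) ell1_complete.

End ell1_complete.

(* The value of a weight sequence at 0 is never used. *)
Record weights (R : realType) := Weights {
  weight :> nat -> R ;
  weight_gt0 : forall n, (0 < n)%N -> 0 < weight n ;
  weight_bounded : exists M, forall n, (0 < n)%N -> weight n <= M
}.

Section wshift.
Context {R : realType} {V : normedModType R} (w : weights R).

Lemma wshift_ell1 (x : ell1 V) : (fun n => w n.+1 *: x n.+1) \in ell1_pred V.
Proof.
have [M wM] := weight_bounded w.
apply: (@ell1_bounded _ _ _ (M * ell1_norm x)) => n.
have M0 : 0 <= M by rewrite (le_trans _ (wM 1%N _))// ltW// weight_gt0.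
apply: le_trans (ler_wpM2l M0 (ell1_series_le x n.+1)).
rewrite /series/= big_nat_recl//= mulrDr mulr_sumr ler_wpDl ?mulr_ge0//.
apply: ler_sum => i _; rewrite normrZ gtr0_norm ?weight_gt0//.
by rewrite ler_wpM2r// wM.
Qed.

Definition wshift (x : ell1 V) : ell1 V := Ell1 (wshift_ell1 x).

Lemma wshift_is_linear : linear wshift.
Proof.
move=> a x y; apply/val_inj/funext => n /=.
rewrite -[LHS]/(w n.+1 *: (a *: x n.+1 + y n.+1)) scalerDr scalerA mulrC.
by rewrite -scalerA.
Qed.

HB.instance Definition _ :=
  GRing.isLinear.Build R (ell1 V) (ell1 V) _ wshift wshift_is_linear.

Lemma wshift_continuous : continuous wshift.
Proof.
have [M wM] := weight_bounded w.
have M0 : 0 <= M by rewrite (le_trans _ (wM 1%N _))// ltW// weight_gt0.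
apply: bounded_linear_continuous; apply/linear_boundedP.
exists M; split; first exact: num_real.
move=> N MN x; apply: ell1_norm_le => n.
apply: le_trans (ler_wpM2l (le_trans M0 (ltW MN)) (ell1_series_le x n.+1)).
rewrite /series/= big_nat_recl//= mulrDr mulr_sumr.
rewrite ler_wpDl ?mulr_ge0// ?(le_trans M0 (ltW MN))//.
apply: ler_sum => i _; rewrite normrZ gtr0_norm ?weight_gt0//.
by rewrite ler_wpM2r// (le_trans (wM _ _))// ltW.
Qed.

End wshift.

Section complex_scalars.
Context {R : realType}.
Implicit Types z : Rcomplex R.

Lemma Rcomplex_normE z : `|z| = Num.sqrt (complex.Re z ^+ 2 + complex.Im z ^+ 2).
Proof. by case: z. Qed.

Lemma Rcomplex_normZ (a : R) z : `|a *: z| = `|a| * `|z|.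
Proof.
case: z => x y; rewrite !Rcomplex_normE /= !exprMn -mulrDr.
by rewrite sqrtrM ?sqr_ge0// sqrtr_sqr.
Qed.

HB.instance Definition _ :=
  PseudoMetric.copy (Rcomplex R) (pseudoMetric_normed (Rcomplex R)).
HB.instance Definition _ := isPointed.Build (Rcomplex R) 0.
HB.instance Definition _ :=
  NormedZmod_PseudoMetric_eq.Build R (Rcomplex R) erefl.
HB.instance Definition _ :=
  PseudoMetricNormedZmod_Lmodule_isNormedModule.Build R (Rcomplex R)
    Rcomplex_normZ.

Lemma Rcomplex_Re_le z : `|complex.Re z| <= `|z|.
Proof.
by rewrite Rcomplex_normE -sqrtr_sqr ler_wsqrtr// lerDl sqr_ge0.
Qed.

Lemma Rcomplex_Im_le z : `|complex.Im z| <= `|z|.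
Proof.
by rewrite Rcomplex_normE -sqrtr_sqr ler_wsqrtr// lerDr sqr_ge0.
Qed.

Lemma Rcomplex_norm_le z : `|z| <= `|complex.Re z| + `|complex.Im z|.
Proof.
rewrite Rcomplex_normE -[leRHS]ger0_norm ?addr_ge0// -sqrtr_sqr.
rewrite ler_wsqrtr// sqrrD !real_normK ?num_real//.
by rewrite addrAC lerDl mulrn_wge0// mulr_ge0.
Qed.

Lemma Rcomplex_complete (F : set_system (Rcomplex R)) :
  ProperFilter F -> cauchy F -> cvg F.
Proof.
move=> FF /cauchy_ballP Fc.
have part (p : Rcomplex R -> R) : (forall z z', p (z - z') = p z - p z') ->
    (forall z, `|p z| <= `|z|) -> cvg (p @ F).
  move=> pB ple; apply/cauchy_cvgP/cauchy_ballP => e e0.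
  have [[A B] [/= FA FB] AB] := Fc e e0.
  exists (p @` A, p @` B) => /=.
    by split; [apply: filterS FA|apply: filterS FB] => x Ax; exists x.
  move=> [_ _] /= [[x Ax <-] [y By <-]].
  have := AB (x, y) (conj Ax By); rewrite -!ball_normE /=.
  by apply: le_lt_trans; rewrite -pB.
have cRe : cvg ((fun z : Rcomplex R => complex.Re z) @ F).
  by apply: part; [move=> [? ?] [? ?]|exact: Rcomplex_Re_le].
have cIm : cvg ((fun z : Rcomplex R => complex.Im z) @ F).
  by apply: part; [move=> [? ?] [? ?]|exact: Rcomplex_Im_le].
pose l : Rcomplex R := Complex (lim ((fun z : Rcomplex R => complex.Re z) @ F))
                               (lim ((fun z : Rcomplex R => complex.Im z) @ F)).
apply/cvg_ex; exists l; apply/cvgrPdist_le => e e0.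
have e20 : 0 < e / 2 by rewrite divr_gt0.
move/cvgrPdist_le : cRe => /(_ _ e20) cRe.
move/cvgrPdist_le : cIm => /(_ _ e20) cIm.
near=> z; apply: le_trans (Rcomplex_norm_le _) _.
rewrite (splitr e) lerD//.
  suff -> : complex.Re (l - z) = lim ((fun z : Rcomplex R => complex.Re z) @ F) - complex.Re z.
    by near: z.
  by case: (z).
suff -> : complex.Im (l - z) = lim ((fun z : Rcomplex R => complex.Im z) @ F) - complex.Im z.
  by near: z.
by case: (z).
Unshelve. all: by end_near. Qed.

HB.instance Definition _ :=
  Uniform_isComplete.Build (Rcomplex R) Rcomplex_complete.

End complex_scalars.

Variant scalar_field := real_scalars | complex_scalars.

(* Complex scalars are viewed as a real Banach space; multiplication by the
   positive real weights is then the real scaling. *)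
Definition scalars (R : realType) (K : scalar_field) : completeNormedModType R :=
  match K with
  | real_scalars => R^o
  | complex_scalars => Rcomplex R
  end.

(* Main.v *)
Require Import Defs.
From mathcomp Require Import all_boot all_order all_algebra.
From mathcomp Require Import all_classical all_reals all_analysis.
From mathcomp Require Import zify ring lra.
Import Order.TTheory GRing.Theory Num.Theory.
Import numFieldNormedType.Exports.
Local Open Scope classical_set_scope.
Local Open Scope ring_scope.
Set Implicit Arguments.
Unset Strict Implicit.
Unset Printing Implicit Defensive.

(** The weights are encoded by a decreasing profile v with v n <= 2 * v n.+1,
through w n = v n.-1 / v n.  Then w 1 * ... * w n = v 0 / v n, and the
coordinate d of the n-th iterate of the shift on x is (v d / v (n + d)) x_(n+d).

Not being rho1-frequently hypercyclic.  If an orbit comes within 1/2 of e_0 at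
all times n of a set A, then |x_n| >= v n / (2 * v 0) on A, so v is summable
on A.  It is thus enough that v be summable on no set of positive lower
rho1-density ([profile_shift_not_frequently_hypercyclic]).

Being rho2-frequently hypercyclic.  Let hit j be the first time n at which
rho2 n >= j.  It is enough that the sum of v (hit j) over j be finite
([profile_shift_frequently_hypercyclic]).  The subadditivity of rho2 makes the
times hit j spread like the integers: for s < t,
hit t - hit s >= hit (t - s - 1).  The classical construction of a frequently
hypercyclic vector, in which blocks z_b are planted along sets of integers, can
therefore be carried out in the scale of the values of rho2.  The i-th block is
planted at time hit (ruler i) and is chosen by b = logn 2 i, the exponent of 2
in i; every b has positive density among the integers i, while the mean of
logn 2 i is bounded.  The ruler leaves around the index i a gap of size at
least logn 2 i and still grows linearly, so every b occurs along times of
positive lower rho2-density ([ruler_valuation_density]).  The interference of later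
blocks is controlled by telescoping: by [tail_dominates], a summable sequence u
comes with q decreasing to 0 such that a multiple c * u n is at most
2 * (q n - q n.+1) as soon as c * q n <= 1.  Blocks of length at most b and cost
at most 1 / q b then contribute at most 2 * q b to the orbit at the times where
z_b is planted ([iter_blocks_near]).  Such blocks still run through a dense set,
each element infinitely often ([scheduled_block_recurs]).

The profile.  As rho1 / rho2 = psi (rho2) / rho2 is unbounded along the
integers, there are N_k >= k with rho1 N_k >= 2 ^ k * rho2 N_k.  The profile is
the sum over k of steps of height 1 / rho1 N_k that are constant up to N_k and
then decay like powers of 1/2, which gives v n <= 2 * v n.+1.  Along the times
hit j the k-th step contributes about rho2 N_k / rho1 N_k <= 2 ^ - k
([sum_hit_decay_le]), whereas along a set of lower rho1-density greater than
d it contributes at least d for every large k ([staircase_diverges]). *)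

(** * Calibration functions and the times at which they reach an integer *)

Section calibration_theory.
Variables (R : realType) (rho : R -> R).
Hypothesis rhoC : calibration rho.

Lemma calibration_lt (s t : R) : 0 <= s -> s < t -> rho s < rho t.
Proof.
move=> s0 st; apply: (calibration_increasing rhoC) => //; rewrite in_itv/= andbT//.
exact: le_trans (ltW st).
Qed.

Lemma calibration_le (s t : R) : 0 <= s -> s <= t -> rho s <= rho t.
Proof.
by move=> s0; rewrite le_eqVlt => /predU1P[->//|/(calibration_lt s0)/ltW].
Qed.

Lemma calibration_gt0 (t : R) : 0 < t -> 0 < rho t.
Proof. by move=> /(calibration_lt (lexx 0)); rewrite (calibration0 rhoC). Qed.

Lemma calibration_le_id (t : R) : 0 <= t -> rho t <= t.
Proof.
move=> t0; have := calibration_lipschitz rhoC t0 (lexx 0).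
by rewrite (calibration0 rhoC) !subr0 !ger0_norm// (calibration_ge0 rhoC).
Qed.

(** As rho t / t is non-increasing, both rho s and rho t are at least the
proportional shares s / (s + t) and t / (s + t) of rho (s + t). *)
Lemma calibration_subadditive (s t : R) : 0 <= s -> 0 <= t ->
  rho (s + t) <= rho s + rho t.
Proof.
rewrite le_eqVlt => /predU1P[<-|s0]; first by rewrite (calibration0 rhoC) !add0r.
rewrite le_eqVlt => /predU1P[<-|t0]; first by rewrite (calibration0 rhoC) !addr0.
have st0 : 0 < s + t by rewrite addr_gt0.
have ratio a : 0 < a -> a <= s + t -> a * (rho (s + t) / (s + t)) <= rho a.
  move=> a0 ast; rewrite mulrC -ler_pdivlMr//.
  by apply: (calibration_ratio rhoC) => //; rewrite in_itv/= andbT.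
rewrite -[leLHS](divfK (lt0r_neq0 st0)) mulrC mulrDl.
by apply: lerD; apply: ratio => //; rewrite (lerDl, lerDr) ltW.
Qed.

Lemma calibration_nat_unbounded M : exists n : nat, M <= rho n%:R.
Proof.
have [t t0 Mt] := calibration_unbounded rhoC M.
exists (Num.truncn t).+1; apply/ltW/(lt_le_trans Mt)/calibration_le => //.
by apply/ltW; rewrite truncnS_gt.
Qed.

Definition hit (j : nat) : nat := ex_minn (calibration_nat_unbounded j%:R).

Lemma hit_leq j n : (hit j <= n)%N = (j%:R <= rho n%:R).
Proof.
rewrite /hit; case: ex_minnP => m jm mmin; apply/idP/idP => [mn|/mmin//].
by apply: (le_trans jm); apply: calibration_le; rewrite ?ler_nat.
Qed.

Lemma le_hit j : j%:R <= rho (hit j)%:R.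
Proof. by rewrite -hit_leq. Qed.

(** A 1-Lipschitz rho cannot jump over an interval of length 1, so at its first
time above j it is still below j + 1. *)
Lemma hit_lt_succ j : rho (hit j)%:R < j.+1%:R.
Proof.
case E : (hit j) => [|n]; first by rewrite (calibration0 rhoC) ltr0n.
have : ~~ (hit j <= n)%N by rewrite E ltnn.
rewrite hit_leq -ltNge => rj.
rewrite -[n.+1]addn1 natrD; apply: (le_lt_trans (calibration_subadditive _ _)) => //.
by rewrite -[j.+1]addn1 natrD ltr_leD// calibration_le_id.
Qed.

Lemma hit0 : hit 0 = 0%N.
Proof. by apply/eqP; rewrite -leqn0 hit_leq (calibration0 rhoC). Qed.

Lemma leq_hit j : (j <= hit j)%N.
Proof. by rewrite -(ler_nat R) (le_trans (le_hit j))// calibration_le_id. Qed.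

Lemma hit_ltn s t : (s < t)%N -> (hit s < hit t)%N.
Proof.
move=> st; rewrite ltnNge hit_leq -ltNge (lt_le_trans (hit_lt_succ s))//.
by rewrite ler_nat.
Qed.

(** Between hit s and hit t the function rho grows by more than t - s - 1, and by
subadditivity it already grows that much on [0, hit t - hit s]. *)
Lemma hit_sub s t : (s < t)%N -> (hit (t - s.+1) <= hit t - hit s)%N.
Proof.
move=> st; have hst := ltnW (hit_ltn st).
rewrite hit_leq natrB// lerBlDr (le_trans (le_hit t))//.
have := @calibration_subadditive (hit t - hit s)%:R (hit s)%:R (ler0n _ _) (ler0n _ _).
rewrite -natrD subnK// => /le_trans; apply.
by rewrite lerD2l ltW// hit_lt_succ.
Qed.

End calibration_theory.

(** * Integers spaced by their 2-adic valuations *)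

Section ruler.

(** Positions of the integers 0, 1, 2, ... once the gap between j and j + 1 is
widened so that the index i is at distance more than logn 2 i from all others. *)
Definition ruler (i : nat) : nat := (\sum_(j < i) (1 + logn 2 j + logn 2 j.+1))%N.

Lemma rulerS i : ruler i.+1 = (ruler i + (1 + logn 2 i + logn 2 i.+1))%N.
Proof. by rewrite /ruler big_ord_recr. Qed.

(** The terms of Legendre's formula are dominated by those of a telescoping sum,
since 2 * (n %/ 2 ^ k) <= n %/ 2 ^ (k - 1). *)
Lemma logn2_fact_leq n : (logn 2 n`! <= n)%N.
Proof.
rewrite logn_fact//.
suff H m : ((\sum_(1 <= k < m.+1) n %/ 2 ^ k) + n %/ 2 ^ m <= n)%N.
  by apply: leq_trans (H n); rewrite leq_addr.
elim: m => [|m IH]; first by rewrite big_geq// expn0 divn1.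
rewrite big_nat_recr//= -addnA; apply: leq_trans IH; rewrite leq_add2l.
by rewrite expnSr divnMA addnn -muln2 leq_trunc_div.
Qed.

(** The sum of the valuations up to i is the valuation of i!, hence at most i: the
widened gaps do not destroy positive density. *)
Lemma ruler_leq i : (ruler i <= 3 * i)%N.
Proof.
have E : (ruler i = i + logn 2 i.-1`! + logn 2 i`!)%N.
  elim: i => [|i IH]; first by rewrite /ruler big_ord0.
  rewrite rulerS IH /= factS lognM ?fact_gt0//.
  case: i {IH} => [|i] //=; rewrite [in RHS]factS lognM ?fact_gt0//; lia.
rewrite E; have := logn2_fact_leq i; have := logn2_fact_leq i.-1; lia.
Qed.

Lemma ruler_gap i j : (i < j)%N ->
  (ruler i + (1 + logn 2 i + logn 2 j) <= ruler j)%N.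
Proof.
elim: j => // j IH; rewrite ltnS leq_eqVlt => /predU1P[->|ij]; first by rewrite rulerS.
by have := IH ij; rewrite rulerS; lia.
Qed.

Lemma ruler_ltn i j : (i < j)%N -> (ruler i < ruler j)%N.
Proof. by move=> /ruler_gap; lia. Qed.

End ruler.

(** * Positive lower density *)

Section density.
Variable R : realType.
Implicit Types (rho : R -> R) (A : set nat) (v : nat -> R).

Definition count_upto A (N : nat) : nat := (\sum_(1 <= n < N.+1 | n \in A) 1)%N.

Lemma lower_density_gt0P rho A : (0 < lower_density rho A)%E <->
  exists2 c : R, 0 < c &
    exists N0, forall N, (N0 <= N)%N -> c <= (count_upto A N)%:R / rho N%:R.
Proof.
rewrite /lower_density limn_einf_lim (cvg_lim _ (@cvg_einfs_sup _ _))//.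
split=> [|[c c0 [N0 H]]].
  move=> /ereal_sup_gt[_ [N0 _ <-]] u0.
  have [c /andP[c0 cu]] : exists c : R, (0 < c) && (c%:E <= einfs
    (fun N => ((count_upto A N)%:R / rho N%:R)%:E) N0)%E.
    move: u0; rewrite -/(count_upto _ _).
    move: (einfs _ _) => e; change ((0 < e)%E -> exists c : R, (0 < c) && (c%:E <= e)%E).
    case: e => [r| |]; rewrite ?lte_fin => r0.
    - by exists r; rewrite r0 /=.
    - by exists 1; rewrite ltr01 leey.
    - by [].
  exists c => //; exists N0 => N N0N; rewrite -lee_fin (le_trans cu)//.
  by apply: ereal_inf_lbound; exists N.
apply: (@lt_le_trans _ _ c%:E); first by rewrite lte_fin.
apply: (@le_trans _ _ (einfs
    (fun N => ((count_upto A N)%:R / rho N%:R)%:E) N0)).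
  by apply: le_ereal_inf_tmp => _ [N N0N <-]; rewrite lee_fin H.
by apply: ereal_sup_ubound; exists N0.
Qed.

Lemma count_upto_image_geq A (f : nat -> nat) k N : injective f ->
  (forall a, (a < k)%N -> [/\ (0 < f a)%N, (f a <= N)%N & A (f a)]) ->
  (k <= count_upto A N)%N.
Proof.
move=> fi fA; rewrite /count_upto sum1_count -size_filter.
rewrite -[k in (k <= _)%N](size_iota 0) -(size_map f).
apply: uniq_leq_size => [|_ /mapP[a + ->]]; first by rewrite map_inj_uniq ?iota_uniq.
rewrite mem_iota add0n => /= /fA[f0 fN Af].
by rewrite mem_filter mem_index_iota mem_set//= f0 ltnS.
Qed.

End density.

(** * Finitely supported vectors of l^1 *)

Section finitely_supported.
Variables (R : realType) (V : normedModType R).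

Lemma ell1_of_seq_subproof (s : seq V) : nth 0 s \in ell1_pred V.
Proof.
apply: (@ell1_bounded _ _ _ (\sum_(0 <= k < size s) `|s`_k|)) => n.
rewrite /series/=; case: (leqP n (size s)) => ns.
  by rewrite (big_cat_nat (n:=n) (p:=size s))//= lerDl sumr_ge0.
rewrite (big_cat_nat (n:=size s) (p:=n))//= 1?ltnW// gerDl.
by rewrite big_nat big1// => k /andP[sk _]; rewrite nth_default ?normr0.
Qed.

Definition ell1_of_seq (s : seq V) : ell1 V := Ell1 (ell1_of_seq_subproof s).

Lemma ell1_of_seqBE (x : ell1 V) (s : seq V) k :
  ((x : nat -> V) - nth 0 s) k = x k - s`_k.
Proof. by []. Qed.

Lemma ell1_of_seq_dense (I : Type) (f : I -> V)
    (f_dense : forall (z : V) (e : R), 0 < e -> exists i, `|z - f i| < e)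
    (x : ell1 V) (e : R) :
  0 < e -> exists s : seq I, `|x - ell1_of_seq (map f s)| < e.
Proof.
move=> e0; have e20 : 0 < e / 2 by rewrite divr_gt0.
have [N xN] : exists N, ell1_norm x - series (fun n => `|x n|) N < e / 2.
  have /cvgrPdist_lt/(_ _ e20)[N _ /(_ N (leqnn N))] := @ell1_cvg _ _ x.
  by move=> /(le_lt_trans (ler_norm _)); exists N.
have /choice[g gx] n : exists i, `|x n - f i| < e / 4 / N.+1%:R.
  by apply: f_dense; rewrite !divr_gt0.
exists [seq g n | n <- iota 0 N].
suff : `|x - ell1_of_seq (map f [seq g n | n <- iota 0 N])| <= e / 2 + e / 4.
  by move=> /le_lt_trans; apply; lra.
apply: ell1_norm_le => M.
apply: (@le_trans _ _ (series (fun k =>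
    `|(x - ell1_of_seq (map f [seq g n | n <- iota 0 N])) k|) (N + M))).
  by apply: nondecreasing_series => //; rewrite leq_addl.
rewrite /series/= (big_cat_nat (n:=N))//= ?leq_addr// addrC lerD//.
  apply/ltW/(le_lt_trans _ xN); rewrite lerBrDl.
  apply: le_trans (ell1_series_le x (N + M)%N).
  rewrite /series/= [leRHS](big_cat_nat (n:=N))//= ?leq_addr// lerD2l.
  apply: ler_sum_nat => k /andP[Nk _].
  by rewrite ell1_of_seqBE nth_default ?size_map ?size_iota// subr0.
apply: (@le_trans _ _ (\sum_(0 <= k < N) (e / 4 / N.+1%:R))).
  apply: ler_sum_nat => k /andP[_ kN].
  rewrite ell1_of_seqBE (nth_map (g 0%N)) ?size_map ?size_iota//.
  by rewrite (nth_map 0%N) ?size_iota// nth_iota// add0n ltW.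
rewrite sumr_const_nat subn0 -[_ *+ N]mulr_natr mulrAC ler_pdivrMr//.
by rewrite ler_wpM2l ?ler_nat// divr_ge0 ?ltW.
Qed.

End finitely_supported.

(** * Weighted shifts given by a decreasing profile *)

Section profile.
Variables (R : realType) (v : nat -> R).
Hypothesis v_gt0 : forall n, 0 < v n.
Hypothesis v_le : {homo v : m n / (m <= n)%N >-> n <= m}.
Hypothesis v_double : forall n, v n <= 2 * v n.+1.

Lemma profile_weight_gt0 n : (0 < n)%N -> 0 < v n.-1 / v n.
Proof. by move=> _; rewrite divr_gt0. Qed.

Lemma profile_weight_bounded :
  exists M, forall n, (0 < n)%N -> v n.-1 / v n <= M.
Proof. by exists 2 => -[//|n] _; rewrite ler_pdivrMr. Qed.

Definition profile_weights : weights R :=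
  Weights profile_weight_gt0 profile_weight_bounded.

Variable V : normedModType R.
Local Notation B := (wshift profile_weights : {linear ell1 V -> _}).

Lemma iter_profile_shift (x : ell1 V) n d :
  iter n B x d = (v d / v (n + d)%N) *: x (n + d)%N.
Proof.
elim: n d => [|n IH] d; first by rewrite /= divff ?lt0r_neq0// scale1r.
rewrite iterS -[LHS]/((v d / v d.+1) *: iter n B x d.+1) IH scalerA addnS.
by rewrite mulrA divfK// lt0r_neq0.
Qed.

(** At a time n at which the orbit is within 1/2 of the first basis vector, the
coordinate 0 of the orbit, that is (v 0 / v n) x_n, has norm at least 1/2; so v
would be summable over the return set. *)
Lemma profile_shift_not_frequently_hypercyclic (rho : R -> R) (e : V) :
  `|e| = 1 ->
  (forall A, (0 < lower_density rho A)%E ->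
     forall M, exists N, M < \sum_(0 <= n < N | n \in A) v n) ->
  ~ frequently_hypercyclic rho B.
Proof.
move=> e1 diverges [x xfhc].
pose e0 := ell1_of_seq [:: e].
have U0 : ball e0 (2^-1 : R) !=set0 by exists e0; exact: ballxx.
have := xfhc _ (ball_open _ _) U0.
set A := [set n | _] => /diverges /(_ (2 * v 0%N * `|x|))[N].
apply/negP; rewrite -leNgt.
have vx n : n \in A -> v n <= 2 * v 0%N * `|x n|.
  rewrite inE /A /= -ball_normE /= => xn.
  have : `|e0 0%N - iter n B x 0%N| < 2^-1.
    exact: le_lt_trans (ell1_coord_le (e0 - iter n B x) 0%N) xn.
  rewrite iter_profile_shift addn0 /= => Bx.
  have : 2^-1 <= `|(v 0%N / v n) *: x n|.
    by have := lerB_dist e ((v 0%N / v n) *: x n); rewrite e1; move: Bx; lra.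
  rewrite normrZ gtr0_norm ?divr_gt0// mulrAC ler_pdivlMr// => vxn.
  by rewrite -mulrA -ler_pdivrMl.
apply: (@le_trans _ _ (\sum_(0 <= n < N) 2 * v 0%N * `|x n|)).
  rewrite [leLHS]big_mkcond; apply: ler_sum => n _.
  by case: ifPn => [/vx//|_]; rewrite !mulr_ge0// ltW.
rewrite -mulr_sumr ler_wpM2l ?mulr_ge0 ?(ltW (v_gt0 _))//.
exact: (ell1_series_le x N).
Qed.

End profile.

(** * Frequent hypercyclicity *)

(** With r the sequence of tails of the series of u, take q = sqrt r: then
u n = q n ^ 2 - q n.+1 ^ 2 is at most 2 * q n * (q n - q n.+1).  This bounds
infinite sums of c n * u n, with unbounded factors c n, by telescoping. *)
Lemma tail_dominates (R : realType) (u : nat -> R) (M : R) :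
  (forall n, 0 <= u n) -> (forall n, \sum_(0 <= k < n) u k <= M) ->
  exists q : nat -> R, [/\ {homo q : m n / (m <= n)%N >-> n <= m},
    forall n, 0 <= q n,
    forall e, 0 < e -> exists n, q n < e &
    forall c n, 0 <= c -> c * q n <= 1 -> c * u n <= 2 * (q n - q n.+1)].
Proof.
move=> u0 uM.
have cu : cvgn (series u).
  apply: nondecreasing_is_cvgn; first exact: nondecreasing_series.
  by exists M => _ [n _ <-]; exact: uM.
pose r n := limn (series u) - series u n.
have r0 n : 0 <= r n.
  by rewrite subr_ge0 nondecreasing_cvgn_le//; exact: nondecreasing_series.
have rS n : r n - r n.+1 = u n.
  by rewrite /r opprB addrC addrA subrK /series/= big_nat_recr//= addrC addKr.
have r_le : {homo r : m n / (m <= n)%N >-> n <= m}.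
  by move=> m n mn; rewrite lerD2l lerN2; exact: nondecreasing_series.
exists (fun n => Num.sqrt (r n)); split.
- by move=> m n mn; rewrite ler_wsqrtr// r_le.
- by move=> n; rewrite sqrtr_ge0.
- move=> e e0.
  have /cvgrPdist_lt/(_ (e ^+ 2))[|N _ /(_ N (leqnn N))] := cu.
    by rewrite exprn_gt0.
  rewrite ger0_norm -/(r N)// => rN; exists N.
  by rewrite -[e]ger0_norm ?ltW// -sqrtr_sqr ltr_sqrt// exprn_gt0.
- move=> c n c0 cq.
  have qle : Num.sqrt (r n.+1) <= Num.sqrt (r n) by rewrite ler_wsqrtr// r_le.
  rewrite -rS -[r n in leLHS]sqr_sqrtr// -[r n.+1 in leLHS]sqr_sqrtr//.
  have := sqrtr_ge0 (r n.+1); move: cq qle.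
  set a := Num.sqrt (r n); set b := Num.sqrt _ => ca ba b0.
  rewrite subr_sqr mulrCA mulrC ler_wpM2r ?subr_ge0// mulrDr.
  have : c * b <= c * a by rewrite ler_wpM2l.
  by lra.
Qed.

Section frequent_hypercyclicity.
Variables (R : realType) (rho : R -> R) (rhoC : calibration rho).
Variables (v : nat -> R).
Hypothesis v_gt0 : forall n, 0 < v n.
Hypothesis v_le : {homo v : m n / (m <= n)%N >-> n <= m}.
Hypothesis v_double : forall n, v n <= 2 * v n.+1.
Variable V : normedModType R.

(** Up to the factor v D, this bounds the norm of the vector that the D-th iterate
of the shift maps to s; see [translate_norm_le]. *)
Definition cost (s : seq V) : R := \sum_(0 <= e < size s) `|s`_e| / v e.

Lemma cost_ge0 s : 0 <= cost s.
Proof. by apply: sumr_ge0 => e _; rewrite divr_ge0// ltW. Qed.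

Lemma sum_nth_cost_le (s : seq V) n : \sum_(0 <= e < n) `|s`_e| / v e <= cost s.
Proof.
rewrite /cost; case: (leqP n (size s)) => ns.
  rewrite [leRHS](big_cat_nat (n:=n))//= lerDl.
  by apply: sumr_ge0 => e _; rewrite divr_ge0// ltW.
rewrite (big_cat_nat (n:=size s))//= 1?ltnW// gerDl.
by rewrite big_nat big1// => k /andP[sk _]; rewrite nth_default ?normr0 ?mul0r.
Qed.

Lemma translate_norm_le (s : seq V) D M :
  \sum_(0 <= d < M | (D <= d)%N) `|(v d / v (d - D)%N) *: s`_(d - D)|
    <= cost s * v D.
Proof.
rewrite big_nat_cond big_mkcond/=.
apply: (@le_trans _ _ (\sum_(0 <= d < D + M)
   (if (D <= d)%N then `|s`_(d - D)| / v (d - D)%N * v D else 0))).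
  rewrite [leRHS](big_cat_nat (n:=M))//= ?leq_addl//.
  rewrite -[leLHS]addr0 lerD//; last first.
    apply: sumr_ge0 => d _; case: ifP => // _.
    by rewrite mulr_ge0 ?divr_ge0 ?(ltW (v_gt0 _)).
  apply: ler_sum_nat => d /andP[_ dM]; rewrite dM /=; case: ifPn => // Dd.
  rewrite normrZ gtr0_norm ?divr_gt0// mulrC -mulrA ler_wpM2l// mulrC.
  by rewrite ler_wpM2l ?invr_ge0 ?(ltW (v_gt0 _))// v_le.
rewrite (big_cat_nat (n:=D))//= ?leq_addr// big_nat big1 ?add0r; last first.
  by move=> d /andP[_ dD]; rewrite leqNgt dD.
rewrite -{1}[D]add0n big_addn addKn.
under eq_bigr do rewrite leq_addl addnK.
by rewrite -mulr_suml ler_wpM2r ?sum_nth_cost_le// ltW.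
Qed.

Variables (z : nat -> seq V) (q : nat -> R).
Hypothesis q_le : {homo q : m n / (m <= n)%N >-> n <= m}.
Hypothesis q_ge0 : forall n, 0 <= q n.
Hypothesis q_dominates : forall c n, 0 <= c -> c * q n <= 1 ->
  c * v (hit rhoC n) <= 2 * (q n - q n.+1).
Hypothesis z_size : forall b, (size (z b) <= b)%N.
Hypothesis z_cost : forall b, cost (z b) * q b <= 1.

(* The block planted at the time tau i is the one scheduled for the valuation of
   i; the index 0 carries no block and stands for the time 0. *)
Let tau i := hit rhoC (ruler i).
Let zi i := z (logn 2 i).

Lemma tau_ltn i j : (i < j)%N -> (tau i < tau j)%N.
Proof. by move=> ij; apply/hit_ltn/ruler_ltn. Qed.

Lemma leq_tau i : (i <= tau i)%N.
Proof. by elim: i => // i IH; apply: leq_ltn_trans IH (tau_ltn _). Qed.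

Lemma tau_sub i j : (i < j)%N ->
  (hit rhoC (ruler j - (ruler i).+1) <= tau j - tau i)%N.
Proof. by move=> ij; apply/hit_sub/ruler_ltn. Qed.

(** The block of an earlier index has been shifted out entirely by the time of a
later index. *)
Lemma size_zi_leq i j : (i < j)%N -> (size (zi i) <= tau j - tau i)%N.
Proof.
move=> ij; apply: leq_trans (z_size _) _; apply: leq_trans (tau_sub ij).
by apply: leq_trans (leq_hit _ _); have := ruler_gap ij; lia.
Qed.

(** The indices ruler i - ruler i0 - 1 at which the bound of [tail_dominates] is
used are strictly increasing in i, so the terms telescope; the widened gaps make
these indices at least logn 2 i, where the cost of the block i is admissible, and
at least logn 2 i0, which gives the bound. *)
Lemma later_cost_le i0 I :
  \sum_(i0.+1 <= i < I) cost (zi i) * v (tau i - tau i0)%N <= 2 * q (logn 2 i0).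
Proof.
case: (leqP I i0) => Ii0; first by rewrite big_geq ?mulr_ge0// ltnW.
suff H : (\sum_(i0.+1 <= i < I) cost (zi i) * v (tau i - tau i0)%N
    <= 2 * (q (logn 2 i0) - q (ruler I - (ruler i0).+1)%N)).
  by apply: (le_trans H); rewrite ler_pM2l// gerBl.
elim: I Ii0 => // I IH; rewrite ltnS leq_eqVlt => /predU1P[<-|i0I].
  rewrite big_geq//. rewrite mulr_ge0// subr_ge0 q_le//.
  by have := ruler_gap (ltnSn i0); lia.
rewrite big_nat_recr//=; apply: le_trans (lerD (IH i0I) (_ : _ <= 2 *
   (q (ruler I - (ruler i0).+1)%N - q (ruler I - (ruler i0).+1).+1))) _.
  apply: (@le_trans _ _ (cost (zi I) * v (hit rhoC (ruler I - (ruler i0).+1)))).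
    by rewrite ler_wpM2l ?cost_ge0// v_le// tau_sub// ltnW.
  apply: q_dominates; rewrite ?cost_ge0//.
  apply: le_trans (z_cost (logn 2 I)); rewrite ler_wpM2l ?cost_ge0// q_le//.
  by have := ruler_gap i0I; lia.
rewrite -mulrDr ler_pM2l// addrA subrK lerD2l lerN2 q_le//.
by have := ruler_ltn (ltnSn I); have := ruler_ltn i0I; lia.
Qed.

(** The coordinate d, at the time tau i0, of the contribution of the blocks with
index strictly between i0 and I. *)
Definition later_blocks i0 I d : V :=
  \sum_(i0.+1 <= i < I | (tau i <= tau i0 + d)%N)
    (v d / v (tau i0 + d - tau i)%N) *: (zi i)`_(tau i0 + d - tau i).

Lemma later_blocks_norm_le i0 I M :
  \sum_(0 <= d < M) `|later_blocks i0 I d| <= 2 * q (logn 2 i0).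
Proof.
apply: le_trans (later_cost_le i0 I).
apply: (@le_trans _ _ (\sum_(0 <= d < M) \sum_(i0.+1 <= i < I | (tau i <= tau i0 + d)%N)
    `|(v d / v (tau i0 + d - tau i)%N) *: (zi i)`_(tau i0 + d - tau i)|)).
  by apply: ler_sum => d _; exact: ler_norm_sum.
under eq_bigr do rewrite big_mkcond/=.
rewrite exchange_big/=; apply: ler_sum_nat => i /andP[i0i _].
rewrite -big_mkcond/=; apply: le_trans (translate_norm_le (zi i) (tau i - tau i0) M).
have ti := ltnW (tau_ltn i0i).
rewrite le_eqVlt; apply/orP; left; apply/eqP; apply: eq_big => [d|d _].
  by rewrite leq_subLR.
by rewrite subnBA// addnC.
Qed.

(** As tau i >= i, no index i > d contributes to the coordinate d, so a finite sum
suffices. *)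
Definition blocks_fun d : V :=
  \sum_(1 <= i < d.+1 | (tau i <= d)%N) (v d / v (d - tau i)%N) *: (zi i)`_(d - tau i).

Lemma blocks_funE I d : (d < I)%N -> blocks_fun d =
  \sum_(1 <= i < I | (tau i <= d)%N) (v d / v (d - tau i)%N) *: (zi i)`_(d - tau i).
Proof.
move=> dI; rewrite [RHS](big_cat_nat (n:=d.+1))//= [X in _ + X]big_nat_cond.
rewrite [X in _ + X]big_pred0 ?addr0// => i; apply/negbTE/negP => /andP[/andP[di _]].
by apply/negP; rewrite -ltnNge (leq_trans di)// leq_tau.
Qed.

(** The vector is the sum of the blocks that come after the index 0, seen from the
time 0. *)
Lemma blocks_ell1 : blocks_fun \in ell1_pred V.
Proof.
apply: (@ell1_bounded _ _ _ (2 * q 0%N)) => M.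
have := later_blocks_norm_le 0 M M; rewrite logn0; apply: le_trans.
apply: ler_sum_nat => d /andP[_ dM]; rewrite (blocks_funE dM) /later_blocks.
have -> : tau 0 = 0%N by rewrite /tau /ruler big_ord0 hit0.
exact: lexx.
Qed.

Definition blocks : ell1 V := Ell1 blocks_ell1.

Local Notation B := (wshift (profile_weights v_gt0 v_double) : {linear ell1 V -> _}).

(** At the time tau i0 the earlier blocks have disappeared, the block i0 has come
to the origin, and the later ones only contribute a small error. *)
Lemma iter_blocks_near i0 : (0 < i0)%N ->
  `|iter (tau i0) B blocks - ell1_of_seq (zi i0)| <= 2 * q (logn 2 i0).
Proof.
move=> i0_gt0; apply: ell1_norm_le => M.
apply: le_trans (later_blocks_norm_le i0 (tau i0 + M).+1 M).
apply: ler_sum_nat => d /andP[_ dM].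
suff -> : (iter (tau i0) B blocks - ell1_of_seq (zi i0)) d =
    later_blocks i0 (tau i0 + M).+1 d by [].
rewrite -[LHS]/(iter (tau i0) B blocks d - (zi i0)`_d) iter_profile_shift /=.
have dI : (tau i0 + d < (tau i0 + M).+1)%N by lia.
have i0I : (i0 < (tau i0 + M).+1)%N by have := leq_tau i0; lia.
rewrite (blocks_funE dI) (big_cat_nat (n:=i0))//=; last exact: ltnW.
(* the earlier blocks vanish *)
rewrite [X in _ *: (X + _)]big1_seq ?add0r; last first.
  move=> i /andP[_]; rewrite mem_index_iota => /andP[_ ii0].
  rewrite nth_default ?scaler0//; apply: leq_trans (size_zi_leq ii0) _.
  by have := tau_ltn ii0; lia.
(* the block i0 itself is restored by the shift *)
rewrite big_ltn_cond// leq_addr addKn scalerDr scalerA.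
rewrite mulrA divfK ?lt0r_neq0// divff ?lt0r_neq0// scale1r addrC addKr.
rewrite scaler_sumr; apply: eq_bigr => i _.
by rewrite scalerA mulrA divfK ?lt0r_neq0.
Qed.

End frequent_hypercyclicity.

(** Among the indices of valuation b are the 2 ^ b * (2 * a + 1), and as
ruler i <= 3 * i, those with 6 * 2 ^ b * (a + 1) <= rho N are hit before N.
There are about rho N / (6 * 2 ^ b) of them; the slightly smaller constant
1 / (12 * 2 ^ b) absorbs the rounding. *)
Lemma ruler_valuation_density (R : realType) (rho : R -> R) (rhoC : calibration rho)
    (A : set nat) (b : nat) :
  (forall i, (0 < i)%N -> logn 2 i = b -> A (hit rhoC (ruler i))) ->
  (0 < lower_density rho A)%E.
Proof.
move=> bA; pose K := (3 * 2 ^ b)%N.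
have K0 : 0 < K%:R :> R by rewrite ltr0n muln_gt0 expn_gt0.
apply/lower_density_gt0P; exists (4 * K%:R)^-1; first by rewrite invr_gt0 mulr_gt0.
exists (hit rhoC (4 * K)) => N; rewrite hit_leq natrM => KN.
have rN0 : 0 < rho N%:R by rewrite (lt_le_trans _ KN)// mulr_gt0.
rewrite ler_pdivlMr//; set x := rho N%:R in KN rN0 *.
pose y := x / (2 * K%:R).
have y0 : 0 <= y by rewrite divr_ge0 ?mulr_ge0 ?ltW.
apply: (@le_trans _ _ (Num.truncn y)%:R).
  have yT : y < (Num.truncn y).+1%:R by rewrite truncnS_gt.
  have y2 : 2 <= y by rewrite ler_pdivlMr ?mulr_gt0// mulrA -natrM.
  have -> : (4 * K%:R)^-1 * x = y / 2.
    by rewrite /y !invfM; field; rewrite lt0r_neq0.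
  by move: yT; rewrite -natr1; lra.
pose odd_times a := hit rhoC (ruler (2 ^ b * (2 * a).+1)%N).
rewrite ler_nat; apply: (@count_upto_image_geq _ odd_times).
  have mono : {homo odd_times : m n / (m < n)%N}.
    move=> m n mn; apply/hit_ltn/ruler_ltn.
    by rewrite ltn_pmul2l ?expn_gt0// ltnS ltn_pmul2l.
  exact: incn_inj (leq_mono mono).
move=> a; have p0 : (0 < 2 ^ b * (2 * a).+1)%N by rewrite muln_gt0 expn_gt0.
rewrite truncn_gt_nat // => ay; split.
- apply: leq_trans (leq_hit _ _); exact: leq_ltn_trans (ruler_ltn p0).
- rewrite hit_leq -/x (@le_trans _ _ (a.+1%:R * (2 * K%:R)))//; last first.
    by rewrite -ler_pdivlMr ?mulr_gt0.
  rewrite -!natrM ler_nat (leq_trans (ruler_leq _))// /K.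
  by move: (2 ^ b)%N => k; nia.
- apply: bA => //; rewrite lognM ?expn_gt0// pfactorK//.
  by rewrite logn_coprime ?addn0// coprime2n /= oddM.
Qed.

Section schedule.
Variables (R : realType) (V : normedModType R) (v : nat -> R) (q : nat -> R).
Variables (I : countType) (f : I -> V).

(** The integer b codes a finite sequence s of indices together with a counter that
makes s recur infinitely often; the block is replaced by the empty one as long
as b is too small for the length and the cost of s. *)
Definition scheduled_block (b : nat) : seq V :=
  if (unpickle b : option (seq I * nat)) is Some (s, _) then
    if (size s <= b)%N && (cost v (map f s) * q b <= 1) then map f s else [::]
  else [::].

Lemma size_scheduled_block b : (size (scheduled_block b) <= b)%N.
Proof.
rewrite /scheduled_block; case: unpickle => [[s _]|]//=.
by case: ifP => // /andP[+ _]; rewrite size_map.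
Qed.

Lemma cost_scheduled_block b : cost v (scheduled_block b) * q b <= 1.
Proof.
have nil_le : cost v ([::] : seq V) * q b <= 1 by rewrite /cost big_geq ?mul0r.
by rewrite /scheduled_block; case: unpickle => [[s _]|]//=; case: ifP => // /andP[].
Qed.

(** The codes of the pairs (s, p) are unbounded in p, and both the length and the
cost condition hold for all large codes since q tends to 0. *)
Lemma scheduled_block_recurs (s : seq I) (n0 : nat) :
  0 <= cost v (map f s) ->
  {homo q : m n / (m <= n)%N >-> n <= m} ->
  (forall e, 0 < e -> exists n, q n < e) ->
  exists2 b, (n0 <= b)%N & scheduled_block b = map f s.
Proof.
move=> c0 q_le q_small.
have [n1 qn1] : exists n, q n < (cost v (map f s) + 1)^-1.
  by apply: q_small; rewrite invr_gt0 ltr_wpDl.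
have [p pn] : exists p : nat, (n0 + n1 + size s <= pickle (s, p))%N.
  apply: contrapT => /forallNP H; set n := (n0 + n1 + size s)%N in H.
  have Hp p : (pickle (s, p) < n)%N by rewrite ltnNge; apply/negP/H.
  have uniqp : uniq [seq pickle (s, p) | p <- iota 0 n.+1].
    by rewrite map_inj_uniq ?iota_uniq// => i j /(pcan_inj pickleK)[].
  have subp : {subset [seq pickle (s, p) | p <- iota 0 n.+1] <= iota 0 n}.
    by move=> _ /mapP[p _ ->]; rewrite mem_iota add0n /=.
  by have := uniq_leq_size uniqp subp; rewrite size_map !size_iota ltnn.
exists (pickle (s, p)); first by lia.
rewrite /scheduled_block pickleK; case: ifPn => // /negP[]; apply/andP.
split; first by lia.
apply: (@le_trans _ _ (cost v (map f s) * (cost v (map f s) + 1)^-1)).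
  by rewrite ler_wpM2l// (le_trans _ (ltW qn1))// q_le//; lia.
by rewrite ler_pdivrMr ?ltr_wpDl// mul1r lerDl.
Qed.

End schedule.

Lemma profile_shift_frequently_hypercyclic (R : realType) (rho : R -> R)
    (rhoC : calibration rho) (v : nat -> R)
    (v_gt0 : forall n, 0 < v n)
    (v_le : {homo v : m n / (m <= n)%N >-> n <= m})
    (v_double : forall n, v n <= 2 * v n.+1)
    (V : normedModType R) (I : countType) (f : I -> V) (M : R) :
  (forall (z : V) (e : R), 0 < e -> exists i, `|z - f i| < e) ->
  (forall n, \sum_(0 <= j < n) v (hit rhoC j) <= M) ->
  frequently_hypercyclic rho
    (wshift (profile_weights v_gt0 v_double) : {linear ell1 V -> _}).
Proof.
move=> f_dense vM.
have [q [q_le q_ge0 q_small q_dom]] :=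
  tail_dominates (fun n => ltW (v_gt0 (hit rhoC n))) vM.
pose z := scheduled_block v q f.
have z_size : forall b, (size (z b) <= b)%N by exact: size_scheduled_block.
have z_cost : forall b, cost v (z b) * q b <= 1 by exact: cost_scheduled_block.
exists (blocks v_gt0 v_le q_le q_ge0 q_dom z_cost) => U oU [y Uy].
have /nbhs_ballP[e /= e0 yU] := open_nbhs_nbhs (conj oU Uy).
have [s ys] := ell1_of_seq_dense f_dense y (divr_gt0 e0 (ltr0n R 2)).
have [n0 qn0] := q_small (e / 4) (divr_gt0 e0 (ltr0n R 4)).
have [b n0b zb] := @scheduled_block_recurs _ _ v q _ f s n0
  (cost_ge0 v_gt0 _) q_le q_small.
apply: (@ruler_valuation_density _ _ rhoC _ b) => i i0 ib; apply: yU.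
rewrite -ball_normE /= -[X in `|X|](subrKA (ell1_of_seq (map f s))).
apply: (le_lt_trans (ler_normD _ _)).
have := iter_blocks_near v_gt0 v_le v_double q_le q_ge0 q_dom z_size z_cost i0.
rewrite ib [z b]zb distrC; have := q_le _ _ n0b.
move: ys qn0; lra.
Qed.

(** * A profile built from geometrically decaying steps *)

Section staircase.
Variables (R : realType) (c : nat -> R) (N : nat -> nat) (C : R).
Hypothesis c_gt0 : forall k, 0 < c k.
Hypothesis c_sum : forall n, \sum_(0 <= k < n) c k <= C.

(** Truncated subtraction makes the step constant, equal to c k, up to N k. *)
Definition stair (n k : nat) : R := c k * 2 ^- (n - N k)%N.

Definition staircase (n : nat) : R := limn (series (stair n)).

Lemma stair_gt0 n k : 0 < stair n k.
Proof. by rewrite mulr_gt0// invr_gt0 exprn_gt0. Qed.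

Lemma stair_le_weight n k : stair n k <= c k.
Proof.
rewrite ler_piMr ?(ltW (c_gt0 _))// invf_le1 ?exprn_gt0//.
by rewrite exprn_ege1// ler1n.
Qed.

Lemma cvg_stair n : cvgn (series (stair n)).
Proof.
apply: nondecreasing_is_cvgn.
  by apply: nondecreasing_series => k _; rewrite ltW ?stair_gt0.
exists C => _ [m _ <-]; apply: le_trans (c_sum m).
by apply: ler_sum => k _; exact: stair_le_weight.
Qed.

Lemma staircase_ge n m : \sum_(0 <= k < m) stair n k <= staircase n.
Proof.
apply: (nondecreasing_cvgn_le _ (@cvg_stair n) m).
by apply: nondecreasing_series => k _; rewrite ltW ?stair_gt0.
Qed.

Lemma staircase_gt0 n : 0 < staircase n.
Proof.
by apply: lt_le_trans (staircase_ge n 1); rewrite big_nat1 stair_gt0.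
Qed.

Lemma staircase_le : {homo staircase : m n / (m <= n)%N >-> n <= m}.
Proof.
move=> m n mn; apply: lim_series_le; [exact: cvg_stair..|] => k.
rewrite ler_wpM2l ?(ltW (c_gt0 _))// lef_pV2 ?posrE ?exprn_gt0//.
by rewrite ler_weXn2l ?ler1n// leq_sub2r.
Qed.

Lemma staircase_double n : staircase n <= 2 * staircase n.+1.
Proof.
apply: limr_le; [exact: cvg_stair|apply: nearW => m].
apply: (le_trans _ (ler_wpM2l (ler0n _ 2) (staircase_ge n.+1 m))).
rewrite mulr_sumr; apply: ler_sum => k _.
rewrite /stair mulrCA ler_wpM2l ?(ltW (c_gt0 _))// ler_pdivlMr ?exprn_gt0//.
rewrite mulrC ler_pdivrMr ?exprn_gt0// -exprS ler_weXn2l ?ler1n//; lia.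
Qed.

Lemma sum_staircase_le (h : nat -> nat) (J : nat) (E : R) :
  (forall m, \sum_(0 <= k < m) \sum_(0 <= j < J) stair (h j) k <= E) ->
  \sum_(0 <= j < J) staircase (h j) <= E.
Proof.
move=> hE.
have cvgJ : (fun m => \sum_(0 <= j < J) series (stair (h j)) m) @ \oo -->
    \sum_(0 <= j < J) staircase (h j).
  elim: J {hE} => [|J IH].
    by under eq_fun do rewrite big_geq//; rewrite big_geq//; exact: cvg_cst.
  under eq_fun do rewrite big_nat_recr//=; rewrite big_nat_recr//=.
  by apply: cvgD => //; exact: cvg_stair.
apply: (cvgr_to_le cvgJ); apply: nearW => m.
by rewrite exchange_big/=.
Qed.

(** For k large, the k-th step takes the value 1 / rho (N k) on at
least d * rho (N k) elements of A, where d is smaller than the lower density. *)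
Lemma staircase_diverges (rho : R -> R) (A : set nat) :
  (forall k, 0 < rho (N k)%:R) ->
  (forall k, c k = (rho (N k)%:R)^-1) ->
  (forall k, (k <= N k)%N) ->
  (0 < lower_density rho A)%E ->
  forall M, exists n0, M < \sum_(0 <= n < n0 | n \in A) staircase n.
Proof.
move=> rhoN cE kN /lower_density_gt0P[d d0 [N0 dA]] M.
(* K steps of index at least N0 contribute at least K * d *)
pose K := (Num.truncn (M / d)).+1.
have MK : M < K%:R * d by rewrite -ltr_pdivrMr// truncnS_gt.
pose m := (N0 + K)%N; pose n0 := (\sum_(0 <= k < m) N k).+1.
have Nn0 k : (k < m)%N -> (N k < n0)%N.
  move=> km; rewrite ltnS (big_cat_nat (n:=k))//=; last exact: ltnW.
  by rewrite [X in (_ + X)%N]big_ltn// addnCA leq_addr.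
exists n0; apply: (lt_le_trans MK).
apply: (@le_trans _ _ (\sum_(0 <= n < n0 | n \in A) \sum_(N0 <= k < m) stair n k)).
  rewrite exchange_big/= (_ : K%:R * d = \sum_(N0 <= k < m) d); last first.
    by rewrite sumr_const_nat /m addKn mulr_natl.
  apply: ler_sum_nat => k /andP[N0k km].
  have := dA (N k) (leq_trans N0k (kN k)); move=> /le_trans; apply.
  rewrite mulrC -cE /stair -mulr_sumr ler_wpM2l ?(ltW (c_gt0 _))//.
  have F0 n : 0 <= (if n \in A then 2 ^- (n - N k)%N else 0 : R).
    by case: ifP => // _; rewrite invr_ge0 exprn_ge0.
  apply: (@le_trans _ _ (\sum_(1 <= n < (N k).+1 | n \in A) 2 ^- (n - N k)%N)).
    rewrite /count_upto natr_sum big_nat_cond [leRHS]big_nat_cond.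
    apply: ler_sum => n /andP[/andP[_ nN] _].
    by rewrite (_ : (n - N k)%N = 0%N) ?expr0 ?invr1//; apply/eqP; rewrite subn_eq0.
  rewrite [leLHS]big_mkcond [leRHS]big_mkcond/=.
  rewrite [leRHS](big_cat_nat (n:=(N k).+1))//=; last exact: Nn0.
  by rewrite [X in _ <= X + _]big_ltn// addrAC lerDr addr_ge0 ?sumr_ge0.
apply: ler_sum => n _; apply: le_trans (staircase_ge n m).
rewrite [leRHS](big_cat_nat (n:=N0))//= ?leq_addr// lerDr.
by apply: sumr_ge0 => k _; rewrite ltW ?stair_gt0.
Qed.

End staircase.

Lemma sum_half_pow_le (R : realType) m (a : R) : 0 <= a ->
  \sum_(0 <= k < m) a * 2 ^- k <= 2 * a.
Proof.
move=> a0; have := @geometric_le_lim R m a 2^-1 a0.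
rewrite invr_gt0 ltr0n ger0_norm ?invr_ge0// invf_lt1// ltr1n => /(_ isT isT).
rewrite (_ : a / (1 - 2^-1) = 2 * a); last by field.
apply: le_trans; rewrite /series/=; apply: ler_sum => k _.
by rewrite exprVn.
Qed.

Lemma sum_half_pow_sub_le (R : realType) t J :
  \sum_(0 <= j < J) 2 ^- (j - t)%N <= t%:R + 2 :> R.
Proof.
elim: t J => [|t IH] J.
  rewrite mulr0n add0r -[leRHS]mulr1; apply: le_trans (sum_half_pow_le J ler01).
  by under eq_bigr do rewrite subn0 -[_^-1]mul1r.
case: J => [|J]; first by rewrite big_geq// addr_ge0.
rewrite big_nat_recl// sub0n expr0 invr1 -[t.+1%:R]natr1.
rewrite [leRHS]addrAC [leLHS]addrC lerD2r.
by apply: le_trans (IH J); under eq_bigr do rewrite subSS.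
Qed.

(** About rho n of the times hit j are at most n, each contributing 1; the later
ones are distinct integers, so they contribute at most a geometric series. *)
Lemma sum_hit_decay_le (R : realType) (rho : R -> R) (rhoC : calibration rho) n J :
  \sum_(0 <= j < J) 2 ^- (hit rhoC j - n)%N <= rho n%:R + 2.
Proof.
set t := Num.truncn (rho n%:R).
have r0 : 0 <= rho n%:R by rewrite (calibration_ge0 rhoC).
apply: le_trans (_ : t%:R + 2 <= _); last by rewrite lerD2r /t truncn_le.
apply: le_trans (sum_half_pow_sub_le _ t J); apply: ler_sum => j _.
rewrite lef_pV2 ?posrE ?exprn_gt0// ler_weXn2l ?ler1n//.
case: (leqP j t) => [|tj]; first by move=> jt; rewrite (_ : (j - t)%N = 0%N)//; lia.
have nt : (n < hit rhoC t.+1)%N by rewrite ltnNge hit_leq -ltNge truncnS_gt.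
have hj : (hit rhoC t.+1 + (j - t.+1) <= hit rhoC j)%N.
  elim: j tj => // j IH; rewrite ltnS leq_eqVlt => /predU1P[->|tj].
    by rewrite subnn addn0.
  by have := IH tj; have := hit_ltn rhoC (ltnSn j); lia.
lia.
Qed.

(** * Scalars *)

Section scalars.
Variable R : realType.

Lemma rat_approx (x e : R) : 0 < e -> exists q : rat, `|x - ratr q| < e.
Proof.
move=> e0; have /rat_in_itvoo[q] : x - e < x + e by rewrite ltrD2l gtrN.
rewrite in_itv/= => /andP[xq qx]; exists q; rewrite distrC ltr_distl.
by rewrite xq qx.
Qed.

Definition rational_scalar (K : scalar_field) (p : rat * rat) : scalars R K :=
  match K with
  | real_scalars => ratr p.1 : R^o
  | complex_scalars => complex.Complex (ratr p.1) (ratr p.2) : complex.Rcomplex R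
  end.

Lemma rational_scalar_dense (K : scalar_field) (z : scalars R K) (e : R) :
  0 < e -> exists p, `|z - rational_scalar K p| < e.
Proof.
case: K z => /= z e0; first by have [q zq] := rat_approx z e0; exists (q, 0).
have e20 : 0 < e / 2 by rewrite divr_gt0.
have [p zp] := rat_approx (complex.Re z) e20.
have [q zq] := rat_approx (complex.Im z) e20.
exists (p, q); apply: le_lt_trans (Rcomplex_norm_le _) _.
by rewrite (splitr e) ltrD//; case: z zp zq.
Qed.

Lemma scalars_unit (K : scalar_field) : exists e : scalars R K, `|e| = 1.
Proof.
case: K => /=; first by exists 1; rewrite normr1.
exists (complex.Complex 1 0 : complex.Rcomplex R).
by rewrite Rcomplex_normE /= expr1n expr0n addr0 sqrtr1.
Qed.

End scalars.

(** * Separating two calibration functions *)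

Lemma calibration_steps (R : realType) (rho1 rho2 psi : R -> R)
    (rho2_calibration : calibration rho2)
    (rho1E : forall t, 0 <= t -> rho1 t = psi (rho2 t))
    (psi_ratio_increasing :
      {in `]0, +oo[ &, {homo (fun t => psi t / t) : s t / s <= t}})
    (psi_ratio_unbounded : forall M A, exists2 t, A < t & M < psi t / t) :
  exists N : nat -> nat, forall k, [/\ (k <= N k)%N, 1 <= rho2 (N k)%:R &
    2 ^+ k * rho2 (N k)%:R <= rho1 (N k)%:R].
Proof.
suff /choice[N NP] : forall k, exists n : nat, [/\ (k <= n)%N, 1 <= rho2 n%:R &
    2 ^+ k * rho2 n%:R <= rho1 n%:R] by exists N.
move=> k.
have [t t1 psit] := psi_ratio_unbounded (2 ^+ k) 1.
have [n0 tn0] := calibration_nat_unbounded rho2_calibration t.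
pose n := maxn k n0.
have tn : t <= rho2 n%:R.
  by apply: (le_trans tn0); apply: calibration_le; rewrite ?ler_nat// leq_maxr.
have t0 : 0 < t by exact: lt_trans t1.
have rn0 : 0 < rho2 n%:R by exact: lt_le_trans tn.
exists n; split; [exact: leq_maxl|exact: le_trans (ltW t1) tn|].
rewrite rho1E// -ler_pdivlMr// (le_trans (ltW psit))//.
by apply: psi_ratio_increasing; rewrite ?in_itv/= ?andbT.
Qed.

Theorem theorem5p1 (R : realType) (K : scalar_field) (rho1 rho2 psi : R -> R)
    (rho1_calibration : calibration rho1)
    (rho2_calibration : calibration rho2)
    (rho1E : forall t, 0 <= t -> rho1 t = psi (rho2 t))
    (psi_ratio_increasing :
      {in `]0, +oo[ &, {homo (fun t => psi t / t) : s t / s <= t}})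
    (psi_ratio_unbounded : forall M A, exists2 t, A < t & M < psi t / t) :
  exists w : weights R,
    frequently_hypercyclic rho2 (wshift w : {linear ell1 (scalars R K) -> _}) /\
    ~ frequently_hypercyclic rho1 (wshift w : {linear ell1 (scalars R K) -> _}).
Proof.
have [N NP] := calibration_steps rho2_calibration rho1E psi_ratio_increasing
  psi_ratio_unbounded.
pose c k := (rho1 (N k)%:R)^-1.
have r1 k : 0 < rho1 (N k)%:R.
  have [_ r2 r12] := NP k; apply: lt_le_trans r12.
  by rewrite mulr_gt0 ?exprn_gt0// (lt_le_trans ltr01).
have c_gt0 k : 0 < c k by rewrite invr_gt0.
have c_rho2 k : c k * rho2 (N k)%:R <= 2 ^- k.
  have [_ _ r12] := NP k.
  by rewrite mulrC ler_pdivrMr// -ler_pdivrMl ?invr_gt0 ?exprn_gt0// invrK.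
have c_sum n : \sum_(0 <= k < n) c k <= 2.
  rewrite -[leRHS]mulr1; apply: le_trans (sum_half_pow_le n ler01).
  apply: ler_sum => k _; rewrite mul1r; apply: le_trans (c_rho2 k).
  by have [_ r2 _] := NP k; rewrite ler_peMr// ltW.
pose v := staircase c N.
have v_gt0 : forall n, 0 < v n := staircase_gt0 N c_gt0 c_sum.
have v_le : {homo v : m n / (m <= n)%N >-> n <= m} :=
  staircase_le N c_gt0 c_sum.
have v_double : forall n, v n <= 2 * v n.+1 := staircase_double N c_gt0 c_sum.
exists (profile_weights v_gt0 v_double); split.
  apply: (@profile_shift_frequently_hypercyclic _ _ rho2_calibration v v_gt0
    v_le v_double (scalars R K) _ (@rational_scalar R K) 6).
    by move=> z e e0; exact: rational_scalar_dense.
  move=> J; apply: sum_staircase_le => // m.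
  rewrite (_ : 6 = 2 * 3); last by ring.
  apply: le_trans (sum_half_pow_le m (ler0n _ 3)).
  apply: ler_sum => k _; rewrite /stair -mulr_sumr.
  have [_ r2 _] := NP k.
  have := sum_hit_decay_le rho2_calibration (N k) J => hk.
  apply: le_trans (ler_wpM2l (ltW (c_gt0 k)) hk) _.
  apply: (@le_trans _ _ (3 * (c k * rho2 (N k)%:R))); last by rewrite ler_wpM2l.
  by rewrite mulrCA ler_wpM2l ?(ltW (c_gt0 k))//; lra.
have [e e1] := scalars_unit R K.
apply: (@profile_shift_not_frequently_hypercyclic _ v v_gt0 v_double
  (scalars R K) rho1 e e1) => A A0.
by apply: (staircase_diverges c_gt0 c_sum r1 _ _ A0) => // k; have [] := NP k.
Qed.
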